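(* Let $n$ be a positive integer, let $\{i_1,\ldots,i_k\}\subseteq\{1,\ldots,n\}$ be any collection of distinct indices, $k\le n$, and let $\alpha,\beta\in\mathscr{IO}_{\infty}(\mathbb{Z}^n_{\mathrm{lex}})$. Put $C=\{1,\ldots,n\}\setminus\{i_1,\ldots,i_k\}$. Then $\alpha\,\sigma_{[i_1,\ldots,i_k]}\,\beta$ if and only if the following conditions hold: (i) there exists a positive integer $p$ such that $(j)\alpha_i=(j)\beta_i$ for all integers $j$ with $|j|\ge p$ and all $i=i_1,\ldots,i_k$; (ii) $\operatorname{dom}\alpha\cap(C\times\mathbb{Z})=\operatorname{dom}\beta\cap(C\times\mathbb{Z})$, and $(j)\alpha_i=(j)\beta_i$ for all $(i,j)\in\operatorname{dom}\alpha\cap(C\times\mathbb{Z})$.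
   Context: $L_n=\{1,\ldots,n\}$ with its usual order; $L_n\times_{\mathrm{lex}}\mathbb{Z}$ is $L_n\times\mathbb{Z}$ with the lexicographic order: $(i,m)\leqslant(j,l)$ iff $i<j$, or $i=j$ and $m\le l$. $\mathscr{IO}_{\infty}(\mathbb{Z}^n_{\mathrm{lex}})$ is the inverse monoid of all injective partial maps $\alpha$ from $L_n\times\mathbb{Z}$ to itself that are monotone ($x\leqslant y$ in $\operatorname{dom}\alpha$ implies $(x)\alpha\leqslant(y)\alpha$) and such that both $\operatorname{dom}\alpha$ and $\operatorname{ran}\alpha$ have finite complement in $L_n\times\mathbb{Z}$; the operation is composition of partial maps written on the right, $(x)(\alpha\beta)=((x)\alpha)\beta$. $\mathscr{IO}_{\infty}(\mathbb{Z})$ is the analogous monoid of injective monotone partial selfmaps of $\mathbb{Z}$ (usual order) with cofinite domain and image. Every element of $\mathscr{IO}_{\infty}(\mathbb{Z}^n_{\mathrm{lex}})$ preserves the first coordinate, so $\mathscr{IO}_{\infty}(\mathbb{Z}^n_{\mathrm{lex}})$ is identified with the direct power $(\mathscr{IO}_{\infty}(\mathbb{Z}))^n$ by $\alpha\leftrightarrow(\alpha_1,\ldots,\alpha_n)$, where $(i,j)\alpha=(i,(j)\alpha_i)$ for $(i,j)\in\operatorname{dom}\alpha$. An equality $(j)\alpha_i=(j)\beta_i$ means that both sides are defined and equal. For $\varepsilon\in\mathscr{IO}_{\infty}(\mathbb{Z})$ let $\varepsilon_i^\circ$ denote the element whose $i$-th coordinate is $\varepsilon$ and whose other coordinates are the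 identity. The congruence $\sigma_{[i]}$ is defined by: $\alpha\,\sigma_{[i]}\,\beta$ iff there exists an idempotent $\varepsilon\in\mathscr{IO}_{\infty}(\mathbb{Z})$ such that $\alpha\varepsilon_i^\circ=\beta\varepsilon_i^\circ$. Further, $\sigma_{[i_1,\ldots,i_k]}=\sigma_{[i_1]}\circ\cdots\circ\sigma_{[i_k]}$ (composition of binary relations: $\alpha(\rho\circ\tau)\beta$ iff $\alpha\rho\gamma$ and $\gamma\tau\beta$ for some $\gamma$). *)

(* Defs.v *)
From HB Require Import structures.
From mathcomp Require Import all_boot all_order all_algebra.
From mathcomp Require Import boolp classical_sets functions cardinality.

Set Implicit Arguments.
Unset Strict Implicit.
Unset Printing Implicit Defensive.

Import Order.TTheory.
Local Open Scope classical_set_scope.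
Local Open Scope order_scope.

Section PartialMaps.
Context {aT rT : Type}.
Implicit Type f : aT -> option rT.

Definition pdom f : set aT := [set x | f x].
Definition pran f : set rT := [set y | exists x, f x = Some y].

(* An equality between two possibly undefined values: both must be defined. *)
Definition both_eq (u v : option rT) : Prop :=
  exists2 l, u = Some l & v = Some l.

End PartialMaps.

Record IOinf (d : Order.disp_t) (T : porderType d) := MkIOinf {
  IOinf_fun :> T -> option T;
  IOinf_inj : forall x y z,
    IOinf_fun x = Some z -> IOinf_fun y = Some z -> x = y;
  IOinf_mono : forall x y x' y',
    IOinf_fun x = Some x' -> IOinf_fun y = Some y' -> x <= y -> x' <= y';
  IOinf_dom : cofinite_set (pdom IOinf_fun);
  IOinf_ran : cofinite_set (pran IOinf_fun)
}.

Section Monoid.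
Context {d : Order.disp_t} {T : porderType d}.
Implicit Types a b c : IOinf T.

Lemma IOinf_ext a b : a =1 b -> a = b.
Proof.
case: a b => [f i1 m1 d1 r1] [g i2 m2 d2 r2] /= /funext fg.
by subst g; congr MkIOinf; exact: Prop_irrelevance.
Qed.

HB.instance Definition _ := gen_eqMixin (IOinf T).
HB.instance Definition _ := gen_choiceMixin (IOinf T).

Definition IOinf_mul_fun a b : T -> option T := pcomp b a.

Definition IOinf_mul_funP a b x z :
  IOinf_mul_fun a b x = Some z <-> exists2 y, a x = Some y & b y = Some z.
Proof.
rewrite /IOinf_mul_fun /pcomp; split; last by move=> [y /= -> /= ->].
by case E: (a x) => [y|] //= byz; exists y.
Qed.

Fact IOinf_mul_inj a b x y z :
  IOinf_mul_fun a b x = Some z -> IOinf_mul_fun a b y = Some z -> x = y.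
Proof.
move=> /IOinf_mul_funP[u au bu] /IOinf_mul_funP[v av bv].
by move: (IOinf_inj bu bv) av => <-; exact: IOinf_inj.
Qed.

Fact IOinf_mul_mono a b x y x' y' :
  IOinf_mul_fun a b x = Some x' -> IOinf_mul_fun a b y = Some y' -> x <= y -> x' <= y'.
Proof.
move=> /IOinf_mul_funP[u au bu] /IOinf_mul_funP[v av bv] xy.
exact: (IOinf_mono bu bv (IOinf_mono au av xy)).
Qed.

Fact IOinf_mul_dom a b : cofinite_set (pdom (IOinf_mul_fun a b)).
Proof.
pose D := \bigcup_(y in ~` pdom b) [set x | a x = Some y].
apply: (@sub_finite_set _ _ (~` pdom a `|` D)).
  move=> x; rewrite /pdom /IOinf_mul_fun /pcomp /=.
  case E: (a x) => [y|] /= bx; last by left.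
  by right; exists y.
rewrite finite_setU; split; first exact: IOinf_dom.
apply: bigcup_finite; first exact: IOinf_dom.
move=> y _; have [[x ax]|no] := pselect (exists x, a x = Some y).
  apply: (@sub_finite_set _ _ [set x]) => // u au.
  exact: IOinf_inj au ax.
by apply: (@sub_finite_set _ _ set0) => // u au; apply: no; exists u.
Qed.

Fact IOinf_mul_ran a b : cofinite_set (pran (IOinf_mul_fun a b)).
Proof.
pose D := \bigcup_(y in ~` pran a) [set z | b y = Some z].
apply: (@sub_finite_set _ _ (~` pran b `|` D)).
  move=> z zab; have [[y byz]|nzb] := pselect (pran b z); last by left.
  right; exists y => //= -[x axy]; apply: zab; exists x.
  by apply/IOinf_mul_funP; exists y.
rewrite finite_setU; split; first exact: IOinf_ran.
apply: bigcup_finite; first exact: IOinf_ran.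
move=> y _; case E: (b y) => [z|].
  by apply: (@sub_finite_set _ _ [set z]) => // u /= [->].
by apply: (@sub_finite_set _ _ set0).
Qed.

(* [IOinf_mul a b] applies [a] first: (x)(ab) = ((x)a)b. *)
Definition IOinf_mul a b : IOinf T :=
  MkIOinf (@IOinf_mul_inj a b) (@IOinf_mul_mono a b) (IOinf_mul_dom a b) (IOinf_mul_ran a b).

Fact IOinf_id_inj (x y z : T) : Some x = Some z -> Some y = Some z -> x = y.
Proof. by move=> [->] [->]. Qed.

Fact IOinf_id_mono (x y x' y' : T) :
  Some x = Some x' -> Some y = Some y' -> x <= y -> x' <= y'.
Proof. by move=> [->] [->]. Qed.

Fact IOinf_id_dom : cofinite_set (pdom (@Some T)).
Proof. by apply: (@sub_finite_set _ _ set0) => // x; exact. Qed.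

Fact IOinf_id_ran : cofinite_set (pran (@Some T)).
Proof. by apply: (@sub_finite_set _ _ set0) => // x; case; exists x. Qed.

Definition IOinf_one : IOinf T := MkIOinf IOinf_id_inj IOinf_id_mono IOinf_id_dom IOinf_id_ran.

Fact IOinf_mulA : associative IOinf_mul.
Proof.
move=> a b c; apply: IOinf_ext => x /=.
by rewrite /IOinf_mul_fun /pcomp /= /IOinf_mul_fun /pcomp; case: (a x).
Qed.

Fact IOinf_1mul : left_id IOinf_one IOinf_mul.
Proof. by move=> a; exact: IOinf_ext. Qed.

Fact IOinf_mul1 : right_id IOinf_one IOinf_mul.
Proof.
by move=> a; apply: IOinf_ext => x; rewrite /= /IOinf_mul_fun /pcomp; case: (a x).
Qed.

HB.instance Definition _ :=
  isMonoid.Build (IOinf T) IOinf_mulA IOinf_1mul IOinf_mul1.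

End Monoid.

(* L_n is represented by 'I_n, i.e. {0, ..., n-1} instead of {1, ..., n}. *)
Notation Zlex n := ('I_n *l int)%type.

Section Coordinates.
Context {n : nat}.

(* (j)alpha_i = l iff (i, j)alpha = (i, l).  The test [k == i] never fails on
   the domain of alpha, since alpha preserves first coordinates. *)
Definition pcoord (a : IOinf (Zlex n)) (i : 'I_n) (j : int) : option int :=
  if a (i, j) is Some (k, l) then if k == i then Some l else None else None.

Section OfCoords.
Variable f : 'I_n -> IOinf int.

Definition of_coords_fun (x : Zlex n) : option (Zlex n) :=
  omap (fun l : int => (x.1, l) : Zlex n) (f x.1 x.2).

Fact of_coords_funP x z : of_coords_fun x = Some z <-> x.1 = z.1 /\ f x.1 x.2 = Some z.2.
Proof.
case: x z => [i j] [k l]; rewrite /of_coords_fun /=; split; last by move=> [-> ->].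
by case: (f i j) => [m|] //= [-> ->].
Qed.

Fact of_coords_inj x y z : of_coords_fun x = Some z -> of_coords_fun y = Some z -> x = y.
Proof.
case: x y z => [i j] [i' j'] [k l] /of_coords_funP /= [-> fj] /of_coords_funP /= [-> fj'].
by rewrite (IOinf_inj fj fj').
Qed.

Fact of_coords_mono x y x' y' :
  of_coords_fun x = Some x' -> of_coords_fun y = Some y' -> x <= y -> x' <= y'.
Proof.
case: x y x' y' => [i j] [i' j'] [k l] [k' l'].
move=> /of_coords_funP /= [-> fj] /of_coords_funP /= [-> fj'].
rewrite !Order.ProdLexiOrder.lexi_pair.
move=> /andP[kk' /implyP jj']; rewrite kk' /=; apply/implyP => k'k.
have kE : k = k' by apply/le_anti; rewrite kk'.
by move: kE fj' => <- fj'; apply: (IOinf_mono fj fj' (jj' k'k)).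
Qed.

Fact of_coords_dom : cofinite_set (pdom of_coords_fun).
Proof.
apply: (@sub_finite_set _ _
  (\bigcup_(i in [set: 'I_n]) (pair i @` ~` pdom (f i)))).
  move=> [i j] ij; exists i => //; exists j => //= fij; apply: ij.
  by move: fij; rewrite /pdom /of_coords_fun /=; case: (f i j).
by apply: bigcup_finite => // i _; apply: finite_image; exact: IOinf_dom.
Qed.

Fact of_coords_ran : cofinite_set (pran of_coords_fun).
Proof.
apply: (@sub_finite_set _ _
  (\bigcup_(i in [set: 'I_n]) (pair i @` ~` pran (f i)))).
  move=> [i l] il; exists i => //; exists l => //= -[j fij]; apply: il.
  by exists (i, j); apply/of_coords_funP.
by apply: bigcup_finite => // i _; apply: finite_image; exact: IOinf_ran.
Qed.

(* The element (f_1, ..., f_n) of the direct power, seen as a partial map of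
   L_n x Z. *)
Definition of_coords : IOinf (Zlex n) :=
  MkIOinf of_coords_inj of_coords_mono of_coords_dom of_coords_ran.

Lemma pcoord_of_coords i : pcoord of_coords i = f i.
Proof.
by apply/funext => j; rewrite /pcoord /= /of_coords_fun /=; case: (f i j) => //= l;
  rewrite eqxx.
Qed.

End OfCoords.

Definition inj_coord (i : 'I_n) (e : IOinf int) : IOinf (Zlex n) :=
  of_coords (fun k => if k == i then e else 1%g).

Definition sigma1 (i : 'I_n) : set (IOinf (Zlex n) * IOinf (Zlex n)) :=
  [set ab | exists e : IOinf int,
    (e * e = e)%g /\ (ab.1 * inj_coord i e = ab.2 * inj_coord i e)%g].

(* In [B \; A] the relation [A] is applied first, so this is
   sigma1 i_1 o (sigma1 i_2 o (... o sigma1 i_k)) with composition written from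
   left to right; the empty composition is the identity relation. *)
Definition sigma (s : seq 'I_n) : set (IOinf (Zlex n) * IOinf (Zlex n)) :=
  foldr (fun i rho => (rho \; sigma1 i)%relation) diagonal s.

End Coordinates.

(* Main.v *)
Require Import Defs.
From mathcomp Require Import all_boot all_order all_algebra.
From mathcomp Require Import boolp classical_sets functions cardinality.
From mathcomp Require Import zify.

(* An element of the monoid over [Zlex n] preserves first coordinates: if
   [i < i'] and two points of the rows [i] and [i'] were sent to the same row,
   then the infinitely many points of the domain lying in row [i] after the
   first one would be injected into a finite interval of that row; so the map
   induces a strictly increasing selfmap of ['I_n], which is the identity.
   Hence every element is a tuple of elements over [int], products and
   [sigma1 i] are computed coordinatewise, and two elements over [int] are
   equalized by an idempotent, i.e. by a partial identity with cofinite domain,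
   iff they are defined and agree outside a finite set. *)

Set Implicit Arguments.
Unset Strict Implicit.
Unset Printing Implicit Defensive.

Import Order.TTheory GRing.Theory Num.Theory.
Local Open Scope classical_set_scope.
Local Open Scope ring_scope.

(** * Finite sets of integers and strictly increasing selfmaps of a finite chain *)

Lemma finite_set_int_bounded (A : set int) :
  finite_set A <-> exists p : nat, forall j, A j -> (`|j| < p)%N.
Proof.
split.
  move=> /finite_seqP[r ->]; exists (\max_(j <- r) `|j|).+1 => j /= jr.
  by rewrite ltnS; apply: (@leq_bigmax_seq _ _ xpredT absz).
move=> [p Ap]; apply: (@sub_finite_set _ _
  ((Posz @` `I_p) `|` ((fun m : nat => - m%:Z) @` `I_p))).
  move=> j /Ap jp; have [j0|j0] := leP 0 j; [left|right]; exists `|j|%N => //; lia.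
by rewrite finite_setU; split; apply: finite_image; exact: finite_II.
Qed.

Lemma infinite_int_ge (j : int) : ~ finite_set [set m | j <= m].
Proof.
move=> /finite_set_int_bounded[p] /(_ (`|j| + p)%N%:Z) /=; lia.
Qed.

(** Strict growth gives [i <= f i] by induction from the bottom, and [f i <= i] by induction on the
    distance [m] to the top. *)
Lemma homo_lt_ord_id (n : nat) (f : 'I_n -> 'I_n) :
  (forall i k : 'I_n, (i < k)%N -> (f i < f k)%N) -> f =1 id.
Proof.
move=> fS.
have ge_id m (i : 'I_n) : i = m :> nat -> (m <= f i)%N.
  elim: m i => // m IHm i im.
  have mn : (m < n)%N by have := ltn_ord i; lia.
  have := IHm (Ordinal mn) erefl; have := fS (Ordinal mn) i; rewrite /= im; lia.
have le_id m (i : 'I_n) : (i + m = n.-1)%N -> (f i + m <= n.-1)%N.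
  elim: m i => [|m IHm] i im; first by have := ltn_ord (f i); lia.
  have mn : (i.+1 < n)%N by lia.
  have := IHm (Ordinal mn); have := fS i (Ordinal mn); rewrite /=; lia.
move=> i; apply: val_inj => /=.
have := ge_id i i erefl; have := le_id (n.-1 - i)%N i; have := ltn_ord i; lia.
Qed.

(** * Idempotents and equalization over a partial order *)

Section Fibres.
Context {d : Order.disp_t} {T : porderType d}.
Implicit Type a : IOinf T.

Lemma IOinf_preimage_finite a (B : set T) :
  finite_set B -> finite_set [set x | exists2 y, B y & a x = Some y].
Proof.
move=> finB; apply: (@sub_finite_set _ _ (\bigcup_(y in B) [set x | a x = Some y])).
  by move=> x [y By axy]; exists y.
apply: bigcup_finite => // y _.
have [[x axy]|no] := pselect (exists x, a x = Some y).
  by apply: (@sub_finite_set _ _ [set x]) => // u /= auy; exact: IOinf_inj auy axy.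
by apply: (@sub_finite_set _ _ set0) => // u auy; apply: no; exists u.
Qed.

Lemma IOinf_image_finite a (B : set T) :
  finite_set B -> finite_set [set y | exists2 x, B x & a x = Some y].
Proof.
move=> finB; apply: (@sub_finite_set _ _ (\bigcup_(x in B) [set y | a x = Some y])).
  by move=> y [x Bx axy]; exists x.
apply: bigcup_finite => // x _.
case axE: (a x) => [y|].
  by apply: (@sub_finite_set _ _ [set y]) => // u /= [->].
by apply: (@sub_finite_set _ _ set0).
Qed.

(** Idempotency makes [e] fix its value [y], so [x] and [y] have the same image and injectivity
    applies. *)
Lemma IOinf_idemP (e : IOinf T) x y : (e * e = e)%g -> e x = Some y -> x = y.
Proof.
move=> ee exy; have : (e * e)%g x = Some y by rewrite ee.
by move=> /IOinf_mul_funP[z exz ezy]; move: exz; rewrite exy => -[yz]; apply: IOinf_inj exy _; rewrite {1}yz.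
Qed.

Section Restriction.
Variables (F : set T) (finF : finite_set F).

Definition restr_id_fun (x : T) : option T := if x \in F then None else Some x.

Fact restr_id_funP x y : restr_id_fun x = Some y <-> x = y /\ ~ F x.
Proof.
rewrite /restr_id_fun; case: ifPn => [|/negP]; rewrite in_setE => Fx; split => //.
- by case.
- by case.
- by case=> ->.
Qed.

Fact restr_id_inj x y z :
  restr_id_fun x = Some z -> restr_id_fun y = Some z -> x = y.
Proof. by move=> /restr_id_funP[-> _] /restr_id_funP[-> _]. Qed.

Fact restr_id_mono x y x' y' :
  restr_id_fun x = Some x' -> restr_id_fun y = Some y' ->
  (x <= y)%O -> (x' <= y')%O.
Proof. by move=> /restr_id_funP[-> _] /restr_id_funP[-> _]. Qed.

Fact restr_id_dom : cofinite_set (pdom restr_id_fun).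
Proof.
apply: sub_finite_set finF => x; apply: contra_notP => nFx.
by rewrite /pdom /=; have -> : restr_id_fun x = Some x by apply/restr_id_funP.
Qed.

Fact restr_id_ran : cofinite_set (pran restr_id_fun).
Proof.
apply: sub_finite_set finF => x; apply: contra_notP => nFx.
by exists x; apply/restr_id_funP.
Qed.

Definition restr_id : IOinf T :=
  MkIOinf restr_id_inj restr_id_mono restr_id_dom restr_id_ran.

Lemma restr_id_idem : (restr_id * restr_id = restr_id)%g.
Proof.
apply: IOinf_ext => x; rewrite [LHS]/= /IOinf_mul_fun /pcomp /= /restr_id_fun.
by case: ifPn => //= /negbTE ->.
Qed.

End Restriction.

(** A point where both maps are undefined does not count as agreement, so [agree f f] is the domain
    of [f]. *)
Definition agree (f g : T -> option T) : set T := [set x | both_eq (f x) (g x)].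

Lemma agree_refl a : cofinite_set (agree a a).
Proof.
apply: sub_finite_set (IOinf_dom a) => x; apply: contra_not.
by rewrite /pdom /agree /=; case: (a x) => // y _; exists y.
Qed.

Lemma idem_equalizerP a b :
  (exists e : IOinf T, (e * e = e)%g /\ (a * e = b * e)%g) <->
  cofinite_set (agree a b).
Proof.
split=> [[e [ee aebe]]|fin_ab].
  (* Since [e] fixes its domain pointwise, disagreement can occur only where [a] is undefined or its
     value is outside the domain of [e]. *)
  apply: (@sub_finite_set _ _
    (~` pdom a `|` [set x | exists2 y, (~` pdom e) y & a x = Some y])).
    move=> x; apply: contra_notP => /not_orP[/contrapT + nB].
    rewrite /pdom /=; case axE: (a x) => [y|] // _.
    have : pdom e y by apply: contrapT => ney; apply: nB; exists y.
    rewrite /pdom /=; case eyE: (e y) => [z|] // _.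
    have yz := IOinf_idemP ee eyE; subst z.
    have : (b * e)%g x = Some y by rewrite -aebe; apply/IOinf_mul_funP; exists y.
    move=> /IOinf_mul_funP[z bxz /(IOinf_idemP ee) zy].
    by exists y => //; rewrite bxz zy.
  rewrite finite_setU; split; first exact: IOinf_dom.
  by apply: IOinf_preimage_finite; exact: IOinf_dom.
(* The idempotent acts on the right, so it has to erase values: those taken by [a] or [b] at points
   of disagreement. *)
pose im (c : IOinf T) := [set y | exists2 x, (~` agree a b) x & c x = Some y].
have finF : finite_set (im a `|` im b).
  by rewrite finite_setU; split; apply: IOinf_image_finite.
exists (restr_id finF); split; first exact: restr_id_idem.
have kill c x : c = a \/ c = b -> ~ agree a b x -> (c * restr_id finF)%g x = None.
  move=> cab nx; case E: ((c * restr_id finF)%g x) => [z|] //.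
  move: E => /IOinf_mul_funP[y cxy /restr_id_funP[_]]; case.
  by case: cab => <-; [left|right]; exists x.
(* On [agree a b] the products coincide whether or not the common value is erased; elsewhere both
   are undefined. *)
apply: IOinf_ext => x; have [[y axy bxy]|nx] := pselect (agree a b x).
  by rewrite /= /IOinf_mul_fun /pcomp axy bxy.
by rewrite !kill; auto.
Qed.

End Fibres.

(** * Preservation of rows and decomposition into coordinates *)

Section Coordinates.
Context {n : nat}.
Implicit Types (a b : IOinf (Zlex n)) (f g : 'I_n -> IOinf int).

Lemma row_finite (A : set (Zlex n)) (i : 'I_n) :
  finite_set A -> finite_set [set j : int | A (i, j)].
Proof.
move=> finA; apply: sub_finite_set (finite_image snd finA).
by move=> j Aij; exists (i, j).
Qed.

Lemma IOinf_row_lt a (i k i' k' : 'I_n) (j l j' l' : int) :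
  a (i, j) = Some (k, l) -> a (i', j') = Some (k', l') ->
  (i < i')%N -> (k < k')%N.
Proof.
move=> ax ay ii'.
have lex_le (u v : 'I_n) (x y : int) :
    (((u, x) : Zlex n) <= ((v, y) : Zlex n))%O = (u <= v)%N && ((v <= u)%N ==> (x <= y)).
  by rewrite Order.ProdLexiOrder.lexi_pair.
have : (k <= k')%N.
  by have := IOinf_mono ax ay; rewrite !lex_le; case/(_ _)/andP => //; lia.
(* Only [k = k'] is left to exclude; [B] is then the finite interval between the two images. *)
rewrite leq_eqVlt => /orP[/eqP/val_inj kk'|//]; subst k'; exfalso.
pose B : set (Zlex n) := pair k @` [set m : int | l <= m <= l'].
have finB : finite_set B.
  apply: finite_image; apply/finite_set_int_bounded.
  by exists (`|l| + `|l'|).+1%N => m /=; lia.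
apply: (@infinite_int_ge j).
apply: (@sub_finite_set _ _ ([set m | (~` pdom a) (i, m)] `|`
    [set m | [set x | exists2 y, B y & a x = Some y] (i, m)])); last first.
  rewrite finite_setU; split; apply: row_finite; first exact: IOinf_dom.
  exact: IOinf_preimage_finite.
move=> m /= jm; rewrite /pdom /=.
case E: (a (i, m)) => [[u y]|]; last by left.
right; exists (u, y) => //.
(* [(i, m)] lies between [(i, j)] and [(i', j')], so its image lies between [(k, l)] and [(k, l')],
   that is, in [B]. *)
have := IOinf_mono ax E; rewrite !lex_le leqnn jm => /(_ isT).
have := IOinf_mono E ay; rewrite !lex_le (ltnW ii') leqNgt ii' => /(_ isT).
move=> /andP[uk /implyP ku] /andP[ku' /implyP uk'].
have ukE : u = k by apply: val_inj; apply/eqP; rewrite eqn_leq uk.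
by exists y; rewrite ?ukE //= uk' ?ku.
Qed.

Lemma IOinf_row a (i k : 'I_n) (j l : int) : a (i, j) = Some (k, l) -> k = i.
Proof.
move=> aij.
(* Each row is infinite, so it meets the cofinite domain. *)
have meet r : exists x : int * (Zlex n), a (r, x.1) = Some x.2.
  apply: contrapT => no; apply: (@infinite_int_ge 0).
  apply: sub_finite_set (row_finite r (IOinf_dom a)) => m _ /=.
  rewrite /pdom /=; case E: (a (r, m)) => [y|] // _.
  by apply: no; exists (m, y).
have [c cP] := choice meet.
(* The chosen point of row [i] is replaced by the given one, so that the induced selfmap of ['I_n]
   sends [i] to [k]. *)
pose c' r := if r == i then (j, (k, l) : Zlex n) else c r.
have c'P r : a (r, (c' r).1) = Some (c' r).2 by rewrite /c'; case: eqP => // ->.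
suff /homo_lt_ord_id/(_ i) :
    forall r r' : 'I_n, (r < r')%N -> ((c' r).2.1 < (c' r').2.1)%N.
  by rewrite /c' eqxx.
move=> r r'; have := c'P r; have := c'P r'.
case: (c' r) => x [u v]; case: (c' r') => x' [u' v'] /= E' E.
exact: IOinf_row_lt E E'.
Qed.

Section Coordinate.
Variables (a : IOinf (Zlex n)) (i : 'I_n).

Lemma pcoordP j l : pcoord a i j = Some l <-> a (i, j) = Some (i, l).
Proof.
rewrite /pcoord; split; last by move=> ->; rewrite eqxx.
by case: (a (i, j)) => [[k m]|] //; case: eqP => // -> [->].
Qed.

Fact pcoord_inj x y z : pcoord a i x = Some z -> pcoord a i y = Some z -> x = y.
Proof. by move=> /pcoordP ax /pcoordP ay; case: (IOinf_inj ax ay). Qed.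

Fact pcoord_mono x y x' y' :
  pcoord a i x = Some x' -> pcoord a i y = Some y' -> (x <= y)%O -> (x' <= y')%O.
Proof.
move=> /pcoordP ax /pcoordP ay xy; have := IOinf_mono ax ay.
by rewrite !Order.ProdLexiOrder.lexi_pair lexx => /(_ xy).
Qed.

Fact pcoord_dom : cofinite_set (pdom (pcoord a i)).
Proof.
apply: sub_finite_set (row_finite i (IOinf_dom a)) => j; apply: contra_not.
rewrite /pdom /=; case E: (a (i, j)) => [[k l]|] // _.
by have kE := IOinf_row E; subst k; move/pcoordP: E => ->.
Qed.

Fact pcoord_ran : cofinite_set (pran (pcoord a i)).
Proof.
apply: sub_finite_set (row_finite i (IOinf_ran a)) => l; apply: contra_not.
by move=> [[k j] E]; exists j; apply/pcoordP; rewrite {1}(IOinf_row E).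
Qed.

Definition coord : IOinf int := MkIOinf pcoord_inj pcoord_mono pcoord_dom pcoord_ran.

End Coordinate.

(** No value is lost in [pcoord] because rows are preserved; arbitrary elements may thus be replaced
    by tuples. *)
Lemma coordK a : of_coords (coord a) = a.
Proof.
apply: IOinf_ext => -[i j] /=; rewrite /of_coords_fun /=.
case E: (a (i, j)) => [[k l]|].
  by have kE := IOinf_row E; subst k; move/pcoordP: E => ->.
by rewrite /pcoord E.
Qed.

Lemma of_coords_inj_fun f g : of_coords f = of_coords g -> f =1 g.
Proof.
by move=> fg i; apply: IOinf_ext => j; rewrite -!pcoord_of_coords fg.
Qed.

Lemma of_coordsM f g :
  (of_coords f * of_coords g)%g = of_coords (fun i => (f i * g i)%g).
Proof.
apply: IOinf_ext => -[i j] /=.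
rewrite /IOinf_mul_fun /pcomp /= /of_coords_fun /= /IOinf_mul_fun /pcomp.
by case: (f i j).
Qed.

(** The factor [inj_coord i e] is [e] in coordinate [i] and [1] in the others, where it forces
    equality. *)
Lemma sigma1P (i : 'I_n) f g :
  sigma1 i (of_coords f, of_coords g) <->
  cofinite_set (agree (f i) (g i)) /\ (forall k, k != i -> f k = g k).
Proof.
rewrite -idem_equalizerP; split.
  move=> [e [ee]] /=; rewrite /inj_coord !of_coordsM => /of_coords_inj_fun fg.
  split; first by exists e; split => //; have := fg i; rewrite eqxx.
  by move=> k /negbTE ki; have := fg k; rewrite ki !mulg1.
move=> [[e [ee fge]] fg]; exists e; split => //=.
rewrite /inj_coord !of_coordsM; congr of_coords; apply/funext => k.
by case: (eqVneq k i) => [->|/fg ->].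
Qed.

Lemma sigmaP (s : seq 'I_n) f g :
  sigma s (of_coords f, of_coords g) <->
  (forall i, i \in s -> cofinite_set (agree (f i) (g i))) /\
  (forall i, i \notin s -> f i = g i).
Proof.
elim: s f g => [|i s IHs] f g /=.
  split=> [/of_coords_inj_fun fg|[_ fg]]; first by split=> // i _; exact: fg.
  by rewrite /diagonal /=; congr of_coords; apply/funext => i; exact: fg.
split.
  move=> [c]; rewrite -(coordK c) => /sigma1P[fci fc] /IHs[cgs cg].
  split=> k; last first.
    by rewrite inE negb_or => /andP[/fc -> /cg ->].
  case: (eqVneq k i) => [-> _|ki]; last by rewrite inE (negbTE ki) fc //; exact: cgs.
  (* If [i] recurs in the tail, the two finite disagreement sets are combined; otherwise [c] and [g]
     coincide at [i]. *)
  have [/cgs fin_cg|/cg <- //] := boolP (i \in s).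
  apply: (@sub_finite_set _ _ (~` agree (f i) (coord c i) `|` ~` agree (coord c i) (g i))).
    move=> j; apply: contra_notP => /not_orP[/contrapT[l fl cl] /contrapT[l' cl' gl']].
    by exists l => //; move: cl'; rewrite gl' cl => -[->].
  by rewrite finite_setU; split.
(* The intermediate element is already [g] in coordinate [i] and still [f] in the others. *)
move=> [fgs fg]; exists (of_coords (fun k => if k == i then g i else f k)).
  apply/sigma1P; rewrite eqxx; split; first by apply: fgs; rewrite inE eqxx.
  by move=> k /negbTE ->.
apply/IHs; split=> k ks.
  case: eqP => [->|_]; first exact: agree_refl.
  by apply: fgs; rewrite inE ks orbT.
by case: eqVneq => [->//|ki]; apply: fg; rewrite inE negb_or ki.
Qed.

End Coordinates.

Theorem proposition2p18 (n : nat) (n_gt0 : (0 < n)%N) (s : seq 'I_n)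
    (s_uniq : uniq s) (a b : IOinf (Zlex n)) :
  let C : set 'I_n := ~` [set` s] in
  sigma s (a, b) <->
  (exists p : nat, (0 < p)%N /\
     forall (i : 'I_n) (j : int), i \in s -> p%:Z <= `|j| ->
       both_eq (pcoord a i j) (pcoord b i j)) /\
  (pdom a `&` (C `*` setT) = pdom b `&` (C `*` setT) /\
   forall (i : 'I_n) (j : int), (pdom a `&` (C `*` setT)) (i, j) ->
     both_eq (pcoord a i j) (pcoord b i j)).
Proof.
move=> C; rewrite -{1}(coordK a) -{1}(coordK b) sigmaP.
have domE (c : IOinf (Zlex n)) i j : pdom c (i, j) <-> pcoord c i j.
  by rewrite -{1}(coordK c) /pdom /= /of_coords_fun /=; case: (pcoord c i j).
split=> [[fin_ab eq_ab]|[[p [_ abp]] [dom_ab eq_ab]]].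
  split.
    (* Bounding the union of the disagreement sets gives one [p] valid for all indices in [s]. *)
    have /finite_set_int_bounded[p abp] :
        finite_set (\bigcup_(i in [set` s]) ~` agree (coord a i) (coord b i)).
      by apply: bigcup_finite => //; exact: finite_seq.
    (* The bound [p] may be [0], whereas a positive one is required. *)
    exists p.+1; split=> // i j si pj; apply: contrapT => nab.
    have : (`|j| < p)%N by apply: abp; exists i.
    lia.
  have pab i : C i -> pcoord a i = pcoord b i.
    by move=> /negP /eq_ab /(congr1 (@IOinf_fun _ _)).
  split.
    apply/seteqP; split=> -[i j] [/domE dij [/= Ci _]]; split=> //; apply/domE.
      by rewrite -pab.
    by rewrite pab.
  move=> i j [/domE dij [/= Ci _]]; rewrite -pab //.
  by move: dij; case: (pcoord a i j) => // l _; exists l.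
split=> i si.
  apply/finite_set_int_bounded; exists p => j nab.
  by rewrite ltnNge; apply/negP => pj; apply: nab; apply: abp => //; lia.
apply: IOinf_ext => j /=; have Ci : C i by apply/negP.
have [aij|naij] := pselect (pdom a (i, j)).
  by have [|l -> ->] := eq_ab i j.
(* Where [a] is undefined, equality of the domains outside [s] makes [b] undefined as well. *)
have nbij : ~ pdom b (i, j).
  move=> bij; apply: naij.
  have : (pdom b `&` (C `*` setT)) (i, j) by [].
  by rewrite -dom_ab => -[].
move: naij nbij; rewrite !domE.
by case: (pcoord a i j); case: (pcoord b i j).
Qed.
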